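(* Let $A,B$ be finite abelian groups of equal order $n$, let $f:A\to B$ be a bijection fixing the identity, and let $G=G(A,B;f)$. Then the metabelian quotient group $G/G''$ is nilpotent of class at most $n$.
   Context: For groups $A,B$ and a bijection $f:A\to B$ with $e^{f}=e$, $G(A,B;f)=\langle A,B\mid aa^{f}=a^{f}a\text{ for all }a\in A\rangle$, i.e. the quotient of the free product $A*B$ by the normal closure of all commutators $[a,a^{f}]$, $a\in A$. $G''$ is the second derived subgroup of $G$. *)

(* Defs.v *)
From HB Require Import structures.
From mathcomp Require Import all_boot.
From mathcomp Require Import boolp classical_sets.

Set Implicit Arguments.
Unset Strict Implicit.
Unset Printing Implicit Defensive.

Local Open Scope quotient_scope.
Local Open Scope classical_set_scope.
Local Open Scope group_scope.

(* The fingroup library only covers finite groups; the notions below are for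
   arbitrary (possibly infinite) groups, with subgroups as classical sets. *)

Section Subgroups.
Variable G : groupType.
Implicit Types (x y : G) (S H K : set G).

Definition is_subgroup H : Prop :=
  [/\ H 1, forall x y, H x -> H y -> H (x * y) & forall x, H x -> H x^-1].

Definition is_normal_subgroup H : Prop :=
  is_subgroup H /\ forall x y, H x -> H (x ^ y).

Definition subgroup_gen S : set G :=
  [set x | forall H, is_subgroup H -> S `<=` H -> H x].

Definition normal_closure S : set G :=
  [set x | forall H, is_normal_subgroup H -> S `<=` H -> H x].

Definition comm_subgroup H K : set G :=
  subgroup_gen [set z | exists x y, [/\ H x, K y & z = [~ x, y]]].

Fixpoint derived_series (i : nat) : set G :=
  if i is j.+1 then comm_subgroup (derived_series j) (derived_series j)
  else setT.

(* Indexed from 0: [lower_central_series i] is gamma_(i+1)(G). *)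
Fixpoint lower_central_series (i : nat) : set G :=
  if i is j.+1 then comm_subgroup (lower_central_series j) setT
  else setT.

Definition nilpotent_of_class_at_most (c : nat) : Prop :=
  lower_central_series c = [set 1].

Lemma normal_closure_normal S : is_normal_subgroup (normal_closure S).
Proof.
split; first split.
- by move=> H [[]].
- move=> x y Sx Sy H nH sSH; case: (nH) => -[_ + _ _].
  by apply; [apply: Sx|apply: Sy].
- by move=> x Sx H nH sSH; case: (nH) => -[_ _ + _]; apply; apply: Sx.
- by move=> x y Sx H nH sSH; case: (nH) => _; apply; apply: Sx.
Qed.

Lemma subgroup_gen_subgroup S : is_subgroup (subgroup_gen S).
Proof.
split.
- by move=> H [].
- by move=> x y Sx Sy H nH sSH; case: (nH) => _ + _; apply; [apply: Sx|apply: Sy].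
- by move=> x Sx H nH sSH; case: (nH) => _ _; apply; apply: Sx.
Qed.

Lemma comm_subgroup_normal H K :
  is_normal_subgroup H -> is_normal_subgroup K ->
  is_normal_subgroup (comm_subgroup H K).
Proof.
move=> [_ nH] [_ nK]; split; first exact: subgroup_gen_subgroup.
move=> x y Sx.
apply: (Sx [set z | comm_subgroup H K (z ^ y)]).
  have [g1 gM gV] := subgroup_gen_subgroup
    [set z | exists x y, [/\ H x, K y & z = [~ x, y]]].
  split => [|u v|u] /=.
  - by rewrite conj1g.
  - by rewrite conjMg; apply: gM.
  - by rewrite conjVg; apply: gV.
move=> _ [u [v [Hu Kv ->]]] L sL; apply.
by exists (u ^ y), (v ^ y); split; [exact: nH | exact: nK | rewrite conjRg].
Qed.

Lemma derived_series_normal i : is_normal_subgroup (derived_series i).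
Proof. by elim: i => [|i IHi]; [|exact: comm_subgroup_normal]. Qed.

End Subgroups.

Record normal_subgroup (G : groupType) := NormalSubgroup {
  normal_subgroup_set :> set G;
  normal_subgroupP : is_normal_subgroup normal_subgroup_set
}.

Section QuotientGroup.
Variables (G : groupType) (N : normal_subgroup G).
Implicit Types x y z : G.

Definition coset_rel : rel G := fun x y => `[< (N : set G) (x^-1 * y) >].

Lemma coset_rel_equiv : equiv_class_of coset_rel.
Proof.
have [[N1 NM NV] _] := normal_subgroupP N.
split=> [x|x y|y x z].
- by apply/asboolP; rewrite mulVg.
- by apply/asboolP/asboolP => /NV; rewrite invgM invgK.
- move=> /asboolP Nxy /asboolP Nyz; apply/asboolP.
  by have := NM _ _ Nxy Nyz; rewrite mulgA mulgK.
Qed.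

Canonical coset_rel_equivRel := EquivRelPack coset_rel_equiv.

Definition quotient_group := {eq_quot coset_rel}.

HB.instance Definition _ : EqQuotient _ coset_rel quotient_group := EqQuotient.on quotient_group.
HB.instance Definition _ := Choice.on quotient_group.

Definition quotient_proj x : quotient_group := \pi_quotient_group x.

Lemma quotient_projP x y :
  quotient_proj x = quotient_proj y <-> (N : set G) (x^-1 * y).
Proof.
split=> [/eqquotP/asboolP //|Nxy].
by apply/eqquotP/asboolP.
Qed.

Definition quotient_mul (u v : quotient_group) : quotient_group :=
  quotient_proj (repr u * repr v).
Definition quotient_inv (u : quotient_group) : quotient_group :=
  quotient_proj (repr u)^-1.

Lemma quotient_reprK (u : quotient_group) : quotient_proj (repr u) = u.
Proof. exact: reprK. Qed.

Lemma quotient_projM x y :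
  quotient_mul (quotient_proj x) (quotient_proj y) = quotient_proj (x * y).
Proof.
have [[N1 NM NV] NJ] := normal_subgroupP N.
apply/quotient_projP; rewrite invgM.
have /quotient_projP Nx := quotient_reprK (quotient_proj x).
have /quotient_projP Ny := quotient_reprK (quotient_proj y).
have := NM _ _ (NJ _ (repr (quotient_proj y)) Nx) Ny.
by rewrite /conjg !mulgA mulgK.
Qed.

Lemma quotient_projV x : quotient_inv (quotient_proj x) = quotient_proj x^-1.
Proof.
have [[N1 NM NV] NJ] := normal_subgroupP N.
apply/quotient_projP; rewrite invgK.
have /quotient_projP Nx := quotient_reprK (quotient_proj x).
by have := NV _ (NJ _ x^-1 Nx); rewrite /conjg invgK mulgK invgM invgK.
Qed.

Fact quotient_mulA : associative quotient_mul.
Proof.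
move=> u v w; rewrite -[u]quotient_reprK -[v]quotient_reprK -[w]quotient_reprK.
by rewrite !quotient_projM mulgA.
Qed.

Fact quotient_mul1 : left_id (quotient_proj 1) quotient_mul.
Proof. by move=> u; rewrite -[u]quotient_reprK quotient_projM mul1g. Qed.

Fact quotient_mulr1 : right_id (quotient_proj 1) quotient_mul.
Proof. by move=> u; rewrite -[u]quotient_reprK quotient_projM mulg1. Qed.

Fact quotient_mulV : left_inverse (quotient_proj 1) quotient_inv quotient_mul.
Proof.
by move=> u; rewrite -[u]quotient_reprK quotient_projV quotient_projM mulVg.
Qed.

Fact quotient_mulrV : right_inverse (quotient_proj 1) quotient_inv quotient_mul.
Proof.
by move=> u; rewrite -[u]quotient_reprK quotient_projV quotient_projM mulgV.
Qed.

HB.instance Definition _ := isGroup.Build quotient_group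
  quotient_mulA quotient_mul1 quotient_mulr1 quotient_mulV quotient_mulrV.

End QuotientGroup.

Section FreeProduct.
Variables A B : groupType.

(* Words over the disjoint union of A and B, modulo the congruence generated
   by the multiplication tables of A and of B. *)
Inductive word_eq : seq (A + B) -> seq (A + B) -> Prop :=
| word_eq_refl w : word_eq w w
| word_eq_sym w1 w2 : word_eq w1 w2 -> word_eq w2 w1
| word_eq_trans w1 w2 w3 : word_eq w1 w2 -> word_eq w2 w3 -> word_eq w1 w3
| word_eq_cat w1 w2 w3 w4 :
    word_eq w1 w2 -> word_eq w3 w4 -> word_eq (w1 ++ w3) (w2 ++ w4)
| word_eq_oneL : word_eq [:: inl 1] [::]
| word_eq_oneR : word_eq [:: inr 1] [::]
| word_eq_mulL a1 a2 : word_eq [:: inl a1; inl a2] [:: inl (a1 * a2)]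
| word_eq_mulR b1 b2 : word_eq [:: inr b1; inr b2] [:: inr (b1 * b2)].

Definition word_rel : rel (seq (A + B)) := fun w1 w2 => `[< word_eq w1 w2 >].

Lemma word_rel_equiv : equiv_class_of word_rel.
Proof.
split=> [w|w1 w2|w2 w1 w3].
- by apply/asboolP; exact: word_eq_refl.
- by apply/asboolP/asboolP; exact: word_eq_sym.
- by move=> /asboolP e12 /asboolP e23; apply/asboolP; exact: word_eq_trans e23.
Qed.

Canonical word_rel_equivRel := EquivRelPack word_rel_equiv.

Definition free_product := {eq_quot word_rel}.

HB.instance Definition _ : EqQuotient _ word_rel free_product := EqQuotient.on free_product.
HB.instance Definition _ := Choice.on free_product.

Definition word_class (w : seq (A + B)) : free_product := \pi_free_product w.

Definition letter_inv (l : A + B) : A + B :=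
  match l with inl a => inl a^-1 | inr b => inr b^-1 end.

Definition word_inv (w : seq (A + B)) : seq (A + B) := rev (map letter_inv w).

Lemma word_classP w1 w2 : word_class w1 = word_class w2 <-> word_eq w1 w2.
Proof. by split=> [/eqquotP/asboolP //|e12]; apply/eqquotP/asboolP. Qed.

Definition free_product_mul (u v : free_product) : free_product :=
  word_class (repr u ++ repr v).
Definition free_product_inv (u : free_product) : free_product :=
  word_class (word_inv (repr u)).

Lemma word_reprK (u : free_product) : word_class (repr u) = u.
Proof. exact: reprK. Qed.

Lemma word_classM w1 w2 :
  free_product_mul (word_class w1) (word_class w2) = word_class (w1 ++ w2).
Proof. by apply/word_classP/word_eq_cat; apply/word_classP; exact: word_reprK. Qed.

Lemma word_inv_cat w1 w2 : word_inv (w1 ++ w2) = word_inv w2 ++ word_inv w1.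
Proof. by rewrite /word_inv map_cat rev_cat. Qed.

Lemma word_inv_eq w1 w2 : word_eq w1 w2 -> word_eq (word_inv w1) (word_inv w2).
Proof.
elim=> {w1 w2} [w|w1 w2 _ IH|w1 w2 w3 _ IH1 _ IH2|w1 w2 w3 w4 _ IH1 _ IH2||||].
- exact: word_eq_refl.
- exact: word_eq_sym.
- exact: word_eq_trans IH2.
- by rewrite !word_inv_cat; exact: word_eq_cat.
- by rewrite /word_inv /= /rev /= invg1; exact: word_eq_oneL.
- by rewrite /word_inv /= /rev /= invg1; exact: word_eq_oneR.
- by move=> a1 a2; rewrite /word_inv /rev /= invgM; exact: word_eq_mulL.
- by move=> b1 b2; rewrite /word_inv /rev /= invgM; exact: word_eq_mulR.
Qed.

Lemma word_classV w : free_product_inv (word_class w) = word_class (word_inv w).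
Proof. by apply/word_classP/word_inv_eq/word_classP; exact: word_reprK. Qed.

Lemma word_invK : involutive word_inv.
Proof.
move=> w; rewrite /word_inv map_rev revK -map_comp map_id_in// => l _ /=.
by case: l => x /=; rewrite invgK.
Qed.

Lemma word_mulV w : word_eq (word_inv w ++ w) [::].
Proof.
elim: w => [|l w IHw]; first exact: word_eq_refl.
have -> : word_inv (l :: w) ++ l :: w
    = word_inv w ++ [:: letter_inv l; l] ++ w.
  by rewrite -cat1s word_inv_cat -!catA.
apply: word_eq_trans IHw; apply: word_eq_cat; first exact: word_eq_refl.
apply: (@word_eq_cat _ [::]); last exact: word_eq_refl.
case: l => [a|b] /=.
- by apply: word_eq_trans (word_eq_mulL _ _) _; rewrite mulVg; exact: word_eq_oneL.
- by apply: word_eq_trans (word_eq_mulR _ _) _; rewrite mulVg; exact: word_eq_oneR.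
Qed.

Fact free_product_mulA : associative free_product_mul.
Proof.
move=> u v w; rewrite -[u]word_reprK -[v]word_reprK -[w]word_reprK.
by rewrite !word_classM catA.
Qed.

Fact free_product_mul1 : left_id (word_class [::]) free_product_mul.
Proof. by move=> u; rewrite -[u]word_reprK word_classM. Qed.

Fact free_product_mulr1 : right_id (word_class [::]) free_product_mul.
Proof. by move=> u; rewrite -[u]word_reprK word_classM cats0. Qed.

Fact free_product_mulV :
  left_inverse (word_class [::]) free_product_inv free_product_mul.
Proof.
move=> u; rewrite -[u]word_reprK word_classV word_classM.
exact/word_classP/word_mulV.
Qed.

Fact free_product_mulrV :
  right_inverse (word_class [::]) free_product_inv free_product_mul.
Proof.
move=> u; rewrite -[u]word_reprK word_classV word_classM -{1}[repr u]word_invK.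
exact/word_classP/word_mulV.
Qed.

HB.instance Definition _ := isGroup.Build free_product
  free_product_mulA free_product_mul1 free_product_mulr1
  free_product_mulV free_product_mulrV.

Definition free_product_inl (a : A) : free_product := word_class [:: inl a].
Definition free_product_inr (b : B) : free_product := word_class [:: inr b].

End FreeProduct.

Section WeakPermutability.
Variables (A B : groupType) (f : A -> B).

Definition weak_perm_relators : set (free_product A B) :=
  [set [~ free_product_inl B a, free_product_inr A (f a)] | a in [set: A]].

Definition weak_perm_kernel : normal_subgroup (free_product A B) :=
  NormalSubgroup (normal_closure_normal weak_perm_relators).

(* G(A,B;f) *)
Definition weak_perm_group : groupType := quotient_group weak_perm_kernel.

End WeakPermutability.

Definition second_derived_subgroup (G : groupType) : normal_subgroup G :=
  NormalSubgroup (derived_series_normal G 2).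

(* G / G'' *)
Definition metabelian_quotient (G : groupType) : groupType :=
  quotient_group (second_derived_subgroup G).

(* Main.v *)
Require Import Defs.
From mathcomp Require Import all_boot all_fingroup.
From mathcomp Require Import zify.

Set Implicit Arguments.
Unset Strict Implicit.

Local Open Scope group_scope.

(** Let [M] be a metabelian group generated by the images [alpha] of [A] and
    [beta] of [B], where [alpha a] commutes with [beta (f a)]; the quotient
    [G / G''] is such a group.  The derived subgroup [M'] is abelian, and the
    operators [v |-> [v, x]] on it are endomorphisms that commute pairwise and
    depend only on [x] modulo [M'].

    The heart of the proof is that [[beta b, alpha a_1, ..., alpha a_k] = 1] for
    all [b] and all [a_i] as soon as [2k > n] ([iter_commg_vanish]).  For a list
    [s] in [A], let [K_s] be the subgroup of those [b] for which
    [[beta b, alpha s] = 1].  It only grows when [s] is extended, and it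
    contains [f a] once [a] is appended to [s], because [alpha a] commutes with
    [beta (f a)] and with [alpha A].  Fix [s] and a further list [t], and let
    [L] be the subgroup of those [a] for which [[beta b, alpha (s, a, t)] = 1]
    for all [b].  If [f a] lies outside [K_s], then appending [a] makes [K_s]
    strictly larger, and induction on the length of [t] gives that [a] is in
    [L].  So every [a] is in [L] or has [f a] in [K_s].  Proper subgroups have
    at most [n / 2] elements, and [L] and the preimage of [K_s] share 1, so
    they cannot cover [A] unless one of [L], [K_s] is the whole group
    ([group_set_cover]); in both cases the commutator vanishes.

    It follows that [[alpha a, beta b]] is killed by any [n - 1] further
    commutations with letters from [alpha A] and [beta B]
    ([iter_commg_letters]): reordering these letters gives [k] entries from [A]
    and [l] entries from [B] in all, with [k + l = n + 1], so one of [2k],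
    [2l] exceeds [n]; the case of [l] uses the symmetric statement, with the
    inverse of [f].  Since [M'] is the normal closure of the [[alpha a, beta b]]
    and the letters generate [M], the term of index [n + 1] of the lower central
    series of [M] is trivial. *)

(** * Commutators in an arbitrary group *)

Section Commutators.
Variable M : groupType.
Implicit Types (x y z u v w : M) (xs ys : seq M).

Lemma commMg_conj x y z : [~ x * y, z] = [~ x, z] ^ y * [~ y, z].
Proof. by rewrite !commgEr conjgM mulgA -conjMg mulgK. Qed.

Lemma commgM_conj x y z : [~ x, y * z] = [~ x, z] * [~ x, y] ^ z.
Proof. by rewrite !commgEl conjgM -mulgA -conjMg mulKVg. Qed.

Lemma subgroup_commgl (N : M -> Prop) z :
  is_normal_subgroup N -> is_subgroup (fun x => N [~ x, z]).
Proof.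
move=> [[N1 NM NV] NJ]; split=> [|x y Nx Ny|x Nx].
- by rewrite comm1g.
- by rewrite commMg_conj; apply: NM => //; exact: NJ.
- have -> : [~ x^-1, z] = ([~ x, z]^-1) ^ x^-1.
    apply: (mulgI ([~ x, z] ^ x^-1)); rewrite -commMg_conj mulgV comm1g.
    by rewrite -conjMg mulgV conj1g.
  exact/NJ/NV.
Qed.

Lemma subgroup_commgr (N : M -> Prop) z :
  is_normal_subgroup N -> is_subgroup (fun x => N [~ z, x]).
Proof.
move=> nN; have [[_ _ NV] _] := nN; have [H1 HM HV] := subgroup_commgl z nN.
have NC x y : N [~ x, y] -> N [~ y, x] by move=> /NV; rewrite invgR.
by split=> [|x y /NC Nx /NC Ny|x /NC Nx]; apply: NC; [|exact: HM|exact: HV].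
Qed.

(** The left-normed commutator [v, x_1, ..., x_k] of [v] and the list
    [x_1; ...; x_k]; it is [v] itself when the list is empty. *)
Definition iter_commg v xs : M := foldl (fun u x => [~ u, x]) v xs.

Lemma iter_commg_cat v xs ys :
  iter_commg v (xs ++ ys) = iter_commg (iter_commg v xs) ys.
Proof. exact: foldl_cat. Qed.

Lemma iter_commg1 xs : iter_commg 1 xs = 1.
Proof. by elim: xs => //= x xs IH; rewrite comm1g. Qed.

Lemma commute_commg x y z :
  commute x y -> commute x z -> commute x [~ y, z].
Proof.
move=> cxy cxz.
apply: commuteM; first exact: commuteV.
apply: commuteM; first exact: commuteV.
exact: commuteM.
Qed.

Lemma commute_iter_commg x v xs :
  commute x v -> (forall y, y \in xs -> commute x y) ->
  commute x (iter_commg v xs).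
Proof.
elim: xs v => //= y xs IH v cv cxs.
apply: IH => [|z zxs]; last by apply: cxs; rewrite inE zxs orbT.
by apply: commute_commg => //; apply: cxs; rewrite mem_head.
Qed.

End Commutators.

Arguments iter_commg {M}.

(** * Commutator operators on an abelian derived subgroup *)

(** A group whose derived subgroup is abelian. *)
Definition metabelian (M : groupType) : Prop :=
  forall u v, @derived_series M 1 u -> @derived_series M 1 v -> commute u v.

Section Metabelian.
Variable M : groupType.
Hypothesis metaM : metabelian M.
Implicit Types (x y z u v w : M) (xs ys : seq M).
Local Notation M' := (@derived_series M 1).

Lemma derived_commg x y : M' [~ x, y].
Proof. by move=> H _; apply; exists x, y. Qed.

(** The element [x ^ g] differs from [x] by a commutator, which acts trivially
    on the derived subgroup. *)
Lemma commg_conj_derived v x g : M' v -> [~ v ^ g, x] = [~ v, x] ^ g.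
Proof.
have [_ M'J] := derived_series_normal M 1.
move=> M'v; rewrite conjRg.
have -> : x ^ g = x * [~ x, g] by rewrite commgEl mulKVg.
rewrite commgM_conj.
have /eqP-> : [~ v ^ g, [~ x, g]] == 1.
  by apply/commgP/metaM; [exact: M'J | exact: derived_commg].
by rewrite mul1g; apply/esym/conjg_fixP/commgP/metaM; exact: derived_commg.
Qed.

Lemma commg_derivedM u v x :
  M' u -> M' v -> [~ u * v, x] = [~ u, x] * [~ v, x].
Proof.
move=> M'u M'v; rewrite commMg_conj; congr (_ * _).
by apply/conjg_fixP/commgP/metaM; first exact: derived_commg.
Qed.

Lemma iter_commg_derived v xs : M' v -> M' (iter_commg v xs).
Proof.
by elim: xs v => //= x xs IH v _; exact: IH (derived_commg _ _).
Qed.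

Lemma iter_commgM u v xs :
  M' u -> M' v -> iter_commg (u * v) xs = iter_commg u xs * iter_commg v xs.
Proof.
elim: xs u v => //= x xs IH u v M'u M'v.
by rewrite commg_derivedM // IH //; exact: derived_commg.
Qed.

Lemma iter_commgV v xs : M' v -> iter_commg v^-1 xs = (iter_commg v xs)^-1.
Proof.
have [[_ _ M'V] _] := derived_series_normal M 1.
move=> M'v; apply: (mulgI (iter_commg v xs)).
by rewrite -iter_commgM ?mulgV ?iter_commg1 //; exact: M'V.
Qed.

Lemma iter_commgJ v g xs :
  M' v -> iter_commg (v ^ g) xs = (iter_commg v xs) ^ g.
Proof.
elim: xs v => //= x xs IH v M'v.
by rewrite commg_conj_derived // IH //; exact: derived_commg.
Qed.

(** The operators [v |-> [v, x]] on the derived subgroup commute pairwise. *)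
Lemma commg_derivedAC v x y : M' v -> [~ v, x, y] = [~ v, y, x].
Proof.
have [[_ _ M'V] M'J] := derived_series_normal M 1.
move=> M'v; rewrite [LHS]commgEl -commg_conj_derived //.
rewrite (commgEl v y) (commg_derivedM x (M'V _ M'v) (M'J _ y M'v)).
congr (_ * _); apply: (mulgI [~ v, x]).
rewrite mulgV -(commg_derivedM x M'v (M'V _ M'v)).
by rewrite mulgV comm1g.
Qed.

Lemma iter_commg_swap v x xs :
  M' v -> iter_commg [~ v, x] xs = [~ iter_commg v xs, x].
Proof.
elim: xs v => //= y xs IH v M'v.
by rewrite commg_derivedAC // IH //; exact: derived_commg.
Qed.

Lemma iter_commg_catC v xs ys :
  M' v -> iter_commg v (xs ++ ys) = iter_commg v (ys ++ xs).
Proof.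
elim: xs v => [|x xs IH] v M'v; first by rewrite cats0.
rewrite /= IH; last exact: derived_commg.
by rewrite !iter_commg_cat iter_commg_swap.
Qed.


(** The elements of the derived subgroup annihilated by the operators of [xs]
    form a normal subgroup. *)
Lemma derived_annihilator_normal (xs : seq M) :
  is_normal_subgroup (fun u => M' u /\ iter_commg u xs = 1).
Proof.
have [[M1 MM MV] MJ] := derived_series_normal M 1.
split; first split.
- by split=> //; exact: iter_commg1.
- move=> u v [M'u u1] [M'v v1]; split; first exact: MM.
  by rewrite iter_commgM // u1 v1 mulg1.
- by move=> u [M'u u1]; split; [exact: MV | rewrite iter_commgV // u1 invg1].
- by move=> u g [M'u u1]; split; [exact: MJ | rewrite iter_commgJ // u1 conj1g].
Qed.

Lemma subgroup_iter_commg xs : is_subgroup (fun y => iter_commg y xs = 1).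
Proof.
case: xs => [|x xs] /=.
  by split=> [|u v -> ->|u ->]; rewrite ?mulg1 ?invg1.
have [H1 HM HV] := subgroup_commgl x (derived_annihilator_normal xs).
split=> [|y z y1 z1|y y1].
- by have [] := H1.
- by have [] : M' [~ y * z, x] /\ iter_commg [~ y * z, x] xs = 1;
    first by apply: HM; split=> //; exact: derived_commg.
- by have [] : M' [~ y^-1, x] /\ iter_commg [~ y^-1, x] xs = 1;
    first by apply: HV; split=> //; exact: derived_commg.
Qed.

Lemma iter_commgMr w x y xs :
  iter_commg w (x :: xs) = 1 -> iter_commg w (y :: xs) = 1 ->
  iter_commg w (x * y :: xs) = 1.
Proof.
have [_ HM _] := subgroup_commgr w (derived_annihilator_normal xs).
move=> x1 y1.
by have [] : M' [~ w, x * y] /\ iter_commg [~ w, x * y] xs = 1;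
  first by apply: HM; split=> //; exact: derived_commg.
Qed.

End Metabelian.

(** * Large subgroups of finite groups *)

Lemma group_set_large (gT : finGroupType) (H : {set gT}) :
  group_set H -> #|[set: gT]| < 2 * #|H| -> H = [set: gT].
Proof.
move=> gH ltH; have := Lagrange (subsetT (Group gH)).
apply: contra_eq => /=; rewrite -subTset -(indexg_eq1 [set: gT] (Group gH)) /=.
have := indexg_gt0 [set: gT] (Group gH); move: ltH; rewrite /=.
move: #|H| #|[set: gT]| #|_ : _| => h g [|[|i]] // ltH _ _.
by rewrite neq_ltn (leq_trans ltH) ?orbT // mulnC leq_mul2l orbT.
Qed.

(** A group is not the union of two proper subgroups when one of them is
    transported by an identity-preserving injection between groups of the same
    order: each has at most half of the elements, and both contain 1. *)
Lemma group_set_cover (A B : finGroupType) (f : A -> B)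
    (K : {set A}) (L : {set B}) :
  injective f -> f 1 = 1 -> #|[set: A]| = #|[set: B]| ->
  group_set K -> group_set L -> (forall a, a \in K \/ f a \in L) ->
  K = [set: A] \/ L = [set: B].
Proof.
move=> f_inj f1 cardAB gK gL KL.
have [K1 _] := group_setP gK; have [L1 _] := group_setP gL.
have cover : K :|: f @^-1: L = [set: A].
  by apply/setP=> a; rewrite !inE; case: (KL a) => ->; rewrite ?orbT.
have cardL : #|f @^-1: L| <= #|L|.
  rewrite -(card_imset _ f_inj); apply: subset_leq_card.
  by apply/subsetP=> _ /imsetP[a + ->]; rewrite inE.
have cardI : 0 < #|K :&: f @^-1: L|.
  by apply/card_gt0P; exists 1; rewrite !inE K1 f1.
have cardU := cardsUI K (f @^-1: L); rewrite cover in cardU.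
have [ltK|leK] := ltnP #|[set: A]| (2 * #|K|).
  by left; exact: group_set_large.
by right; apply: group_set_large => //; rewrite -cardAB; lia.
Qed.

(** * Commutators of one element of [B] with many elements of [A] *)

Section WeaklyPermuting.
Variables (M : groupType) (A B : finGroupType).
Variables (alpha : A -> M) (beta : B -> M) (f : A -> B).
Hypothesis metaM : metabelian M.
Hypothesis alphaM : {morph alpha : x y / x * y}.
Hypothesis betaM : {morph beta : x y / x * y}.
Hypothesis abelA : abelian [set: A].
Hypothesis cardAB : #|[set: A]| = #|[set: B]|.
Hypothesis f_inj : injective f.
Hypothesis f1 : f 1 = 1.
Hypothesis f_comm : forall a, commute (alpha a) (beta (f a)).
Implicit Types (s t : seq A).

Lemma morph_group1 (gT : finGroupType) (phi : gT -> M) :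
  {morph phi : x y / x * y} -> phi 1 = 1.
Proof. by move=> phiM; apply: (mulgI (phi 1)); rewrite -phiM !mulg1. Qed.

(** The subgroup [K_s] of those [b] for which the commutator of [beta b] with
    the images of the entries of [s] is trivial. *)
Definition commg_kernel s : {set B} :=
  [set b | iter_commg (beta b) (map alpha s) == 1].

Lemma group_set_commg_kernel s : group_set (commg_kernel s).
Proof.
have [H1 HM _] := subgroup_iter_commg metaM (map alpha s).
apply/group_setP; split=> [|x y]; rewrite !inE.
  by rewrite (morph_group1 betaM) H1.
by move=> /eqP x1 /eqP y1; rewrite betaM HM.
Qed.

Lemma commg_kernel_rcons s a :
  f a |: commg_kernel s \subset commg_kernel (rcons s a).
Proof.
apply/subsetP=> b; rewrite !inE map_rcons -cats1 iter_commg_cat /=.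
case/orP=> [/eqP->|/eqP->]; last by rewrite comm1g.
rewrite commg1_sym; apply/commgP/commute_iter_commg => // _ /mapP[c _ ->].
rewrite /commute -!alphaM; congr alpha.
by apply: (centsP abelA); rewrite inE.
Qed.

(** The bound on [t] is relative to the size of [K_s], which makes an induction
    on [t] possible. *)
Lemma iter_commg_vanish_cat s t b :
  #|[set: A]| < 2 * (#|commg_kernel s| + size t) ->
  iter_commg (beta b) (map alpha (s ++ t)) = 1.
Proof.
elim: t s b => [|a t IH] s b lt_n.
  rewrite cats0; apply/eqP.
  suff: b \in commg_kernel s by rewrite inE.
  rewrite (group_set_large (group_set_commg_kernel s)) ?inE //.
  by rewrite -cardAB; rewrite addn0 in lt_n.
(* Either all choices of the letter [a] work, or [K_s] is already everything. *)
pose L := [set x | [forall y, iter_commg (beta y) (map alpha (s ++ x :: t)) == 1]].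
have gL : group_set L.
  apply/group_setP; split=> [|x y]; rewrite !inE.
    apply/forallP=> y; rewrite map_cat /= iter_commg_cat /=.
    by rewrite (morph_group1 alphaM) commg1 iter_commg1.
  move=> /forallP Lx /forallP Ly; apply/forallP=> z.
  have := Ly z; have := Lx z; rewrite !map_cat !iter_commg_cat /= alphaM.
  by move=> /eqP x1 /eqP y1; apply/eqP/(iter_commgMr metaM).
have cover x : x \in L \/ f x \in commg_kernel s.
  have [fx|fx] := boolP (f x \in commg_kernel s); [by right | left].
  rewrite inE; apply/forallP=> y; rewrite -cat_rcons; apply/eqP/IH.
  (* Appending [x] adds at least the new element [f x] to [K_s]. *)
  have := subset_leq_card (commg_kernel_rcons s x).
  by rewrite cardsU1 fx; move: lt_n => /=; lia.
have [LT|KT] := group_set_cover f_inj f1 cardAB gL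
                  (group_set_commg_kernel s) cover.
  have : a \in L by rewrite LT inE.
  by rewrite inE => /forallP/(_ b)/eqP.
have : b \in commg_kernel s by rewrite KT inE.
by rewrite inE map_cat iter_commg_cat => /eqP->; rewrite iter_commg1.
Qed.

Lemma iter_commg_vanish t b :
  #|[set: A]| < 2 * size t -> iter_commg (beta b) (map alpha t) = 1.
Proof. by move=> lt_n; apply: (iter_commg_vanish_cat (s := [::])); lia. Qed.

End WeaklyPermuting.

(** * Nilpotency of a metabelian group generated by both images *)

Section Generation.
Variables (M : groupType) (A B : finGroupType).
Variables (alpha : A -> M) (beta : B -> M) (f : A -> B).
Hypothesis metaM : metabelian M.
Hypothesis alphaM : {morph alpha : x y / x * y}.
Hypothesis betaM : {morph beta : x y / x * y}.
Hypothesis abelA : abelian [set: A].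
Hypothesis abelB : abelian [set: B].
Hypothesis cardAB : #|[set: A]| = #|[set: B]|.
Hypothesis bij_f : bijective f.
Hypothesis f1 : f 1 = 1.
Hypothesis f_comm : forall a, commute (alpha a) (beta (f a)).
Hypothesis genM : forall H : M -> Prop, is_subgroup H ->
  (forall a, H (alpha a)) -> (forall b, H (beta b)) -> forall x, H x.

(** A letter is an element of [A] or of [B]; this is its image in [M]. *)
Definition letter_val (l : A + B) : M :=
  match l with inl a => alpha a | inr b => beta b end.

(** Up to the order of the operators, the letters from [A] come first. *)
Lemma iter_commg_sort (ls : seq (A + B)) :
  exists (s : seq A) (t : seq B), size s + size t = size ls /\
    forall v, @derived_series M 1 v ->
      iter_commg v (map letter_val ls) =
      iter_commg v (map alpha s ++ map beta t).
Proof.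
elim: ls => [|l ls [s [t [size_st IH]]]]; first by exists [::], [::].
case: l => [a|b] /=.
  exists (a :: s), t; split=> [|v _]; first by rewrite /= -size_st.
  by rewrite IH //; exact: derived_commg.
exists s, (b :: t); split=> [|v M'v]; first by rewrite /= -size_st addnS.
rewrite IH; last exact: derived_commg.
by rewrite !iter_commg_cat (iter_commg_swap metaM).
Qed.

Lemma iter_commg_letters a b (ls : seq (A + B)) :
  size ls = #|[set: A]|.-1 ->
  iter_commg [~ alpha a, beta b] (map letter_val ls) = 1.
Proof.
have [g fK gK] := bij_f.
have cA : 0 < #|[set: A]| by apply/card_gt0P; exists 1; rewrite inE.
move=> size_ls; have [s [t [size_st ->]]] := iter_commg_sort ls.
  (* With [alpha a] and [beta b] there are [(size s).+1] letters from [A] and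
     [(size t).+1] from [B], which makes [n + 1] in all. *)
  have [lt_s|ge_s] := ltnP #|[set: A]| (2 * (size s).+1).
    rewrite iter_commg_cat -invgR (iter_commgV metaM); last exact: derived_commg.
    have -> : iter_commg [~ beta b, alpha a] (map alpha s) = 1.
      exact: (iter_commg_vanish metaM alphaM betaM abelA cardAB
                (bij_inj bij_f) f1 f_comm (t := a :: s)).
    by rewrite invg1 iter_commg1.
  have lt_t : #|[set: A]| < 2 * (size t).+1 by lia.
  rewrite (iter_commg_catC metaM); last exact: derived_commg.
  rewrite iter_commg_cat.
  have -> : iter_commg [~ alpha a, beta b] (map beta t) = 1.
    apply: (iter_commg_vanish metaM betaM alphaM abelB (esym cardAB)
              (can_inj gK) _ _ (t := b :: t)).
    - by rewrite -f1 fK.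
    - by move=> c; apply: commute_sym; rewrite -{2}[c]gK.
    - by rewrite -cardAB.
  by rewrite iter_commg1.
exact: derived_commg.
Qed.

(** The elements of the derived subgroup killed by every left-normed commutator
    with [j] further letters. *)
Definition letters_kernel j : M -> Prop := fun v =>
  @derived_series M 1 v /\
  forall ls : seq (A + B), size ls = j -> iter_commg v (map letter_val ls) = 1.

Lemma letters_kernel_normal j : is_normal_subgroup (letters_kernel j).
Proof.
have [[M1 MM MV] MJ] := derived_series_normal M 1.
have K ls := derived_annihilator_normal metaM (map letter_val ls).
split; first split.
- by split=> // ls _; rewrite iter_commg1.
- move=> u v [M'u uj] [M'v vj]; split=> [|ls ls_j]; first exact: MM.
  by rewrite (iter_commgM metaM) // uj // vj // mulg1.
- move=> u [M'u uj]; split=> [|ls ls_j]; first exact: MV.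
  by rewrite (iter_commgV metaM) // uj // invg1.
- move=> u x [M'u uj]; split=> [|ls ls_j]; first exact: MJ.
  by rewrite (iter_commgJ metaM) // uj // conj1g.
Qed.

Lemma letters_kernel_commg j v x :
  letters_kernel j.+1 v -> letters_kernel j [~ v, x].
Proof.
move=> [M'v vj].
apply: (genM (subgroup_commgr v (letters_kernel_normal j))) => c.
- split=> [|ls ls_j]; first exact: derived_commg.
  by apply: (vj (inl c :: ls)); rewrite /= ls_j.
- split=> [|ls ls_j]; first exact: derived_commg.
  by apply: (vj (inr c :: ls)); rewrite /= ls_j.
Qed.

(** Since the images of [A] and [B] are abelian and generate, the derived
    subgroup is the normal closure of the commutators [[alpha a, beta b]]. *)
Lemma derived_subset_normal (N : M -> Prop) :
  is_normal_subgroup N -> (forall a b, N [~ alpha a, beta b]) ->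
  forall v, @derived_series M 1 v -> N v.
Proof.
move=> nN Nab; have [sN _] := nN; have [N1 _ NV] := sN.
have comm_img (gT : finGroupType) (phi : gT -> M) x y :
    abelian [set: gT] -> {morph phi : x y / x * y} -> N [~ phi x, phi y].
  move=> ab phiM; suff /eqP-> : [~ phi x, phi y] == 1 by [].
  apply/commgP; rewrite /commute -!phiM; congr phi.
  by apply: (centsP ab); rewrite inE.
have Nba b a : N [~ beta b, alpha a] by rewrite -invgR; apply: NV.
have Nxa a x : N [~ x, alpha a].
  by apply: (genM (subgroup_commgl (alpha a) nN)) => [c|c] //; exact: comm_img.
have Nxb b x : N [~ x, beta b].
  by apply: (genM (subgroup_commgl (beta b) nN)) => [c|c] //; exact: comm_img.
move=> v; apply=> // _ [x [y [_ _ ->]]].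
exact: (genM (subgroup_commgr x nN)).
Qed.

Lemma lower_central_letters_kernel i j :
  (i + j).+1 = #|[set: A]| ->
  forall v, @lower_central_series M i.+1 v -> letters_kernel j v.
Proof.
elim: i j => [|i IH] j eq_n.
  apply: derived_subset_normal; first exact: letters_kernel_normal.
  move=> a b; split=> [|ls ls_j]; first exact: derived_commg.
  by apply: iter_commg_letters; rewrite ls_j -eq_n.
have [sK _] := letters_kernel_normal j.
move=> v; apply=> // _ [x [y [Lx _ ->]]].
by apply: letters_kernel_commg; apply: IH Lx; rewrite addnS -eq_n.
Qed.

Lemma nilpotent_of_generation : nilpotent_of_class_at_most M #|[set: A]|.
Proof.
have /prednK <- : 0 < #|[set: A]| by apply/card_gt0P; exists 1; rewrite inE.
set i := _.-1.
have eq_n : (i + 0).+1 = #|[set: A]|.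
  by rewrite addn0 prednK //; apply/card_gt0P; exists 1; rewrite inE.
apply/classical_sets.seteqP; split=> v.
  by move=> /(lower_central_letters_kernel eq_n)[_ /(_ [::])]; apply.
by move->; have [] := subgroup_gen_subgroup
  (fun z => exists x y : M, [/\ lower_central_series i x, True & z = [~ x, y]]).
Qed.

End Generation.

(** * Quotient groups and the free product *)

Section Quotients.
Variables (G : groupType) (N : normal_subgroup G).

Lemma quotient_proj_mul x y :
  quotient_proj N (x * y) = quotient_proj N x * quotient_proj N y.
Proof. by rewrite -quotient_projM. Qed.

Lemma quotient_proj_inv x : quotient_proj N x^-1 = (quotient_proj N x)^-1.
Proof. by rewrite -quotient_projV. Qed.

Lemma quotient_proj_commg x y :
  quotient_proj N [~ x, y] = [~ quotient_proj N x, quotient_proj N y].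
Proof. by rewrite !(quotient_proj_mul, quotient_proj_inv). Qed.

Lemma quotient_proj1 : quotient_proj N 1 = 1.
Proof. by []. Qed.

Lemma quotient_proj_eq1 x :
  normal_subgroup_set N x -> quotient_proj N x = 1.
Proof.
have [[_ _ NV] _] := normal_subgroupP N.
by move=> /NV Nx; apply/quotient_projP; rewrite mulg1.
Qed.

Lemma is_subgroup_quotient_preim (H : Defs.quotient_group N -> Prop) :
  is_subgroup H -> is_subgroup (fun x => H (quotient_proj N x)).
Proof.
move=> [H1 HM HV]; split=> // [x y Hx Hy|x Hx].
- by rewrite quotient_proj_mul; apply: HM.
- by rewrite quotient_proj_inv; apply: HV.
Qed.

Lemma derived_series_quotient i (u : Defs.quotient_group N) :
  derived_series i u -> exists2 x, derived_series i x & quotient_proj N x = u.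
Proof.
elim: i u => [|i IH] u Du.
  by exists (generic_quotient.repr u) => //; exact: quotient_reprK.
have [[D1 DM DV] _] := derived_series_normal G i.+1.
apply: (Du (fun v => exists2 x, derived_series i.+1 x & quotient_proj N x = v)).
  split=> [|_ _ [x Dx <-] [y Dy <-]|_ [x Dx <-]].
  - by exists 1.
  - by exists (x * y); [exact: DM | exact: quotient_proj_mul].
  - by exists x^-1; [exact: DV | exact: quotient_proj_inv].
move=> _ [_ [_ [/IH[x Dx <-] /IH[y Dy <-] ->]]].
exists [~ x, y]; last exact: quotient_proj_commg.
by move=> H _; apply; exists x, y.
Qed.

End Quotients.

Lemma metabelian_quotientP (G : groupType) : metabelian (metabelian_quotient G).
Proof.
move=> _ _ /derived_series_quotient[x Dx <-] /derived_series_quotient[y Dy <-].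
apply/commgP/eqP; rewrite -quotient_proj_commg; apply: quotient_proj_eq1.
by move=> H _; apply; exists x, y.
Qed.

Section FreeProductGenerators.
Variables A B : groupType.

Lemma free_product_inlM :
  {morph @free_product_inl A B : x y / x * y}.
Proof.
move=> x y; rewrite [RHS]word_classM; apply/word_classP/word_eq_sym.
exact: word_eq_mulL.
Qed.

Lemma free_product_inrM :
  {morph @free_product_inr A B : x y / x * y}.
Proof.
move=> x y; rewrite [RHS]word_classM; apply/word_classP/word_eq_sym.
exact: word_eq_mulR.
Qed.

Lemma free_product_gen (H : free_product A B -> Prop) :
  is_subgroup H -> (forall a, H (free_product_inl B a)) ->
  (forall b, H (free_product_inr A b)) -> forall x, H x.
Proof.
move=> [H1 HM _] Ha Hb x; rewrite -[x]word_reprK.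
elim: (generic_quotient.repr x) => // l w IH.
rewrite -cat1s -word_classM; apply: HM => //.
by case: l.
Qed.

End FreeProductGenerators.

Unset Implicit Arguments.

Theorem theorem3 (n : nat) (A B : finGroupType) (f : A -> B)
    (abelA : abelian [set: A]) (abelB : abelian [set: B])
    (cardA : #|[set: A]| = n) (cardB : #|[set: B]| = n)
    (bij_f : bijective f) (f1 : f 1 = 1) :
  nilpotent_of_class_at_most (metabelian_quotient (weak_perm_group f)) n.
Proof.
pose pi x : metabelian_quotient (weak_perm_group f) :=
  quotient_proj _ (quotient_proj (weak_perm_kernel f) x).
have piM : {morph pi : x y / x * y}.
  by move=> x y; rewrite /pi !quotient_proj_mul.
rewrite -cardA; apply: (nilpotent_of_generation
  (alpha := fun a => pi (free_product_inl B a))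
  (beta := fun b => pi (free_product_inr A b)) (f := f)) => //.
- exact: metabelian_quotientP.
- by move=> x y; rewrite free_product_inlM piM.
- by move=> x y; rewrite free_product_inrM piM.
- by rewrite cardA cardB.
- move=> a; apply/commgP/eqP; rewrite /pi -!quotient_proj_commg.
  rewrite [X in quotient_proj _ X]quotient_proj_eq1 ?quotient_proj1 //.
  by move=> H _; apply; exists a.
- move=> H sH Ha Hb u; rewrite -[u]quotient_reprK -[generic_quotient.repr u]quotient_reprK.
  apply: (free_product_gen (H := fun x => H (pi x))) => //.
  exact/(is_subgroup_quotient_preim (is_subgroup_quotient_preim sH)).
Qed.
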